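(* Let $\Pi$ be the pattern of some directed acyclic graph, and let $\Pi_0$ be the result of applying the orientation rules R1, R2 and R3 to $\Pi$ repeatedly until none of them is applicable. Then $\Pi_0$ is a maximally oriented graph for $\Pi$ (with no background knowledge): for each undirected edge $A-B$ of $\Pi_0$ there exist consistent DAG extensions $G_1$ and $G_2$ of $\Pi_0$ such that $A\to B$ is in $G_1$ and $B\to A$ is in $G_2$.
   Context: All graphs are finite. A partially directed graph is a graph that may have both undirected edges ($A-B$) and directed edges ($A\to B$), with at most one edge between any pair of (distinct) vertices. Two vertices are adjacent if they are joined by an edge of either kind. The pattern of a partially directed graph $G$, $\mathrm{pattern}(G)$, is the partially directed graph with the same adjacencies as $G$ which has a directed edge $A\to B$ if and only if $A\to B$ is in $G$ and there is a vertex $C\neq A$ not adjacent to $A$ with $C\to B$ in $G$ (all other edges are undirected). A partially directed graph $G$ extends a partially directed graph $H$ if they have the same vertices and adjacencies and every directed edge $A\to B$ of $H$ is a directed edge $A\to B$ of $G$. $G$ is a consistent DAG extension of $H$ if $G$ extends $H$, $G$ is a directed acyclic graph, and $\mathrm{pattern}(G)=\mathrm{pattern}(H)$. Orientation rules (in each rule the named vertices are distinct; applying a rule replaces an undirected edge by a directed one): R1: if $X\to Y$, $Y-Z$, and $X,Z$ are not adjacent, then orient $Y\to Z$. R2: if $X\to Y$, $Y\to Z$ and $X-Z$, then orient $X\to Z$. R3: if $X-Y$, $X-Z$, $X-W$, $Y\to W$, $Z\to W$, and $Y,Z$ are not adjacent, then orient $X\to W$. *)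

(* Defs.v *)
From mathcomp Require Import all_boot.
From Stdlib Require Import Relation_Operators.

Set Implicit Arguments.
Unset Strict Implicit.
Unset Printing Implicit Defensive.

(* [u] is the symmetric set of ordered pairs of ends of the undirected edges,
   and [d] is the set of directed edges. *)
Definition pdgraph_axiom (T : finType) (u d : {set T * T}) : bool :=
  [&& [forall x, ((x, x) \notin u) && ((x, x) \notin d)],
      [forall x, forall y, ((x, y) \in u) ==> ((y, x) \in u)]
    & [forall x, forall y, ((x, y) \in d) ==>
         ((y, x) \notin d) && ((x, y) \notin u)]].

(* Edges are stored as finite sets so that Leibniz equality of graphs is
   equality of edge sets; see [pdgraph_ext]. *)
Record pdgraph (T : finType) := PDGraph {
  uset : {set T * T};
  dset : {set T * T};
  _ : pdgraph_axiom uset dset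
}.

Section PDGraph.
Variable T : finType.
Implicit Types (G H : pdgraph T) (x y z w a b c : T).

Definition und G : rel T := fun x y => (x, y) \in uset G.
Definition dir G : rel T := fun x y => (x, y) \in dset G.
Definition adj G : rel T := fun x y => [|| und G x y, dir G x y | dir G y x].

Lemma pdgraph_ext G H : und G =2 und H -> dir G =2 dir H -> G = H.
Proof.
case: G H => [u d p] [u' d' p'] eu ed.
have e1 : u = u' by apply/setP=> -[x y]; exact: eu.
have e2 : d = d' by apply/setP=> -[x y]; exact: ed.
by subst; rewrite (bool_irrelevance p p').
Qed.

Lemma und_irrefl G x : und G x x = false.
Proof.
case: G => u d p; apply: negbTE.
by have /and3P [/forallP /(_ x) /andP []] := p.
Qed.

Lemma dir_irrefl G x : dir G x x = false.
Proof.
case: G => u d p; apply: negbTE.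
by have /and3P [/forallP /(_ x) /andP []] := p.
Qed.

Lemma und_sym G x y : und G x y = und G y x.
Proof.
case: G => u d p; have /and3P [_ /forallP h _] := p.
by apply/idP/idP; [have /forallP/(_ y)/implyP := h x
                  | have /forallP/(_ x)/implyP := h y].
Qed.

Lemma dir_asym G x y : dir G x y -> ~~ dir G y x && ~~ und G x y.
Proof.
case: G => u d p; have /and3P [_ _ /forallP/(_ x)/forallP/(_ y)/implyP] := p.
exact.
Qed.

Definition unshielded_arc G a b : bool :=
  dir G a b && [exists c, [&& c != a, ~~ adj G c a & dir G c b]].

Definition pattern_dset G : {set T * T} :=
  [set e : T * T | unshielded_arc G e.1 e.2].

Definition pattern_uset G : {set T * T} :=
  [set e : T * T | [&& adj G e.1 e.2, e \notin pattern_dset G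
                     & (e.2, e.1) \notin pattern_dset G]].

Lemma pattern_subproof G : pdgraph_axiom (pattern_uset G) (pattern_dset G).
Proof.
apply/and3P; split.
- apply/forallP=> x.
  by rewrite !inE /= /unshielded_arc /adj und_irrefl dir_irrefl.
- apply/forallP=> x; apply/forallP=> y; apply/implyP; rewrite !inE /=.
  case/and3P=> axy -> ->; rewrite !andbT.
  by move: axy; rewrite /adj und_sym [dir G x y || _]orbC.
apply/forallP=> x; apply/forallP=> y; apply/implyP=> sxy.
rewrite [(x, y) \in pattern_uset G]inE sxy /= andbF andbT.
move: sxy; rewrite !inE /= /unshielded_arc => /andP [/dir_asym /andP [n _] _].
by rewrite (negbTE n).
Qed.

Definition pattern G : pdgraph T := PDGraph (pattern_subproof G).

Definition is_dag G : Prop :=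
  (forall x y, ~~ und G x y) /\ (forall s : seq T, cycle (dir G) s -> s = [::]).

Definition extends G H : Prop := adj G =2 adj H /\ subrel (dir H) (dir G).

Definition consistent_dag_extension G H : Prop :=
  [/\ extends G H, is_dag G & pattern G = pattern H].

Definition ruleR1 G y z : Prop :=
  exists x, [/\ uniq [:: x; y; z], dir G x y, und G y z & ~~ adj G x z].

Definition ruleR2 G x z : Prop :=
  exists y, [/\ uniq [:: x; y; z], dir G x y, dir G y z & und G x z].

Definition ruleR3 G x w : Prop :=
  exists y z,
    [/\ uniq [:: x; y; z; w],
        [/\ und G x y, und G x z & und G x w],
        dir G y w /\ dir G z w
      & ~~ adj G y z].

(* Some rule licenses replacing the undirected edge a - b by a -> b. *)
Definition rule_applies G a b : Prop :=
  [\/ ruleR1 G a b, ruleR2 G a b | ruleR3 G a b].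

Definition rule_step G H : Prop :=
  exists a b,
    [/\ rule_applies G a b,
        uset H = uset G :\: [set (a, b); (b, a)]
      & dset H = (a, b) |: dset G].

(* The order of application is arbitrary, so this is a relation. *)
Definition rule_closure G H : Prop :=
  clos_refl_trans _ rule_step G H /\ (forall a b, ~ rule_applies H a b).

Definition maximally_oriented H : Prop :=
  forall a b, und H a b ->
    exists G1 G2,
      [/\ consistent_dag_extension G1 H, consistent_dag_extension G2 H,
          dir G1 a b & dir G2 b a].

End PDGraph.

(* Main.v *)
Require Import Defs.
From mathcomp Require Import all_boot zify.
From Stdlib Require Import Relation_Operators Operators_Properties.

(** Write [H] for the closed graph and [D] for a DAG with the given pattern.
    The rules are sound, so [D] extends [H].  The key fact, proved by induction
    on the moment at which [a -> b] is oriented, is that [a -> b - c] in [H]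
    forces [a -> c] in [H].  It has two consequences.  First, the directed edges
    of [H] can be combined with any acyclic orientation of the undirected part
    without creating a cycle, because vertices joined by an undirected edge have
    the same parents.  Second, [D] orders the vertices so that the undirected
    neighbours preceding any given vertex form a clique (the undirected part is
    chordal).  Such an ordering can be changed to start with any prescribed
    vertex, in particular with either end of the given edge. *)

Set Implicit Arguments.
Unset Strict Implicit.
Unset Printing Implicit Defensive.

(** * Perfect orderings and moving a clique to the front *)

Section ReorderClique.
Variables (T : finType) (e : rel T).
Implicit Types (A B K : {set T}) (r : T -> nat).

Definition clique K := {in K &, forall x y, x != y -> e x y}.

(** The reverse of a perfect elimination ordering; ranks need to differ only along edges, so [r] may
    have ties elsewhere. *)
Definition perfect_rank A r :=
  {in A &, forall x y, e x y -> r x != r y} /\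
  {in A & &, forall x y z,
    e x z -> e y z -> r x < r z -> r y < r z -> x != y -> e x y}.

Lemma perfect_rankS A B r : A \subset B -> perfect_rank B r -> perfect_rank A r.
Proof.
move=> /subsetP sAB [inj cl]; split; first exact: sub_in2 inj.
by move=> x y z /sAB xB /sAB yB /sAB zB; exact: cl.
Qed.

(** Induction on [#|A|], removing a vertex [s] of maximal rank, whose neighbourhood [N] is a clique.
    If [s] is outside [K], it goes last. Otherwise the induction hypothesis is used with [N] in
    place of [K], which is why arbitrary cliques are allowed. *)
Lemma perfect_rank_prefix A K r0 : symmetric e -> irreflexive e ->
  perfect_rank A r0 -> K \subset A -> clique K ->
  exists2 r, perfect_rank A r & {in K & A :\: K, forall x y, r x < r y}.
Proof.
move=> esym eirr; move: {2}#|A| (erefl #|A|) => n.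
elim: n A K => [|n IHn] A K cardA pA sKA clK.
  have A0 : A = set0 by apply/eqP; rewrite -cards_eq0 cardA.
  by exists r0 => // x y _; rewrite A0 !inE andbF.
have [s0 s0A] : exists s0, s0 \in A by apply/card_gt0P; rewrite cardA.
have [s sA smax] : exists2 s, s \in A & {in A, forall x, r0 x <= r0 s}.
  by have [s sA smax] := arg_maxnP r0 s0A; exists s.
have cardB : #|A :\ s| = n by have := cardsD1 s A; rewrite sA cardA => -[].
have pB : perfect_rank (A :\ s) r0 := perfect_rankS (subsetDl _ _) pA.
pose N := [set x in A | e x s].
have clN : clique N.
  move=> x y; rewrite !inE => /andP [xA xs] /andP [yA ys] xy.
  case: pA => inj0 cl0.
  by apply: (cl0 _ _ s) => //; rewrite ltn_neqAle inj0 ?smax.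
have [sK|sK] := boolP (s \in K); last first.
  have sKB : K \subset A :\ s by rewrite subsetD1 sKA.
  have [r [inj cl] rK] := IHn _ _ cardB pB sKB clK.
  pose B := (\max_x r x).+1.
  have rB x : r x < B by rewrite ltnS leq_bigmax.
  pose r' x := if x == s then B else r x.
  have r's : r' s = B by rewrite /r' eqxx.
  have r'E x : x != s -> r' x = r x by rewrite /r' => /negbTE ->.
  have inA x : x \in A -> x != s -> x \in A :\ s by move=> xA xs; rewrite !inE xs.
  exists r'; first split.
  - move=> x y xA yA exy.
    have [xs|xs] := eqVneq x s; have [ys|ys] := eqVneq y s.
    + by move: exy; rewrite xs ys eirr.
    + by rewrite xs r's r'E // gtn_eqF.
    + by rewrite ys r's r'E // ltn_eqF.
    by rewrite !r'E //; apply: inj => //; exact: inA.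
  - move=> x y z xA yA zA exz eyz xz yz xy.
    have xs : x != s.
      apply: contraTneq xz => ->; rewrite r's -leqNgt /r'.
      by case: ifP => // _; exact: ltnW.
    have ys : y != s.
      apply: contraTneq yz => ->; rewrite r's -leqNgt /r'.
      by case: ifP => // _; exact: ltnW.
    have [zs|zs] := eqVneq z s.
      by rewrite zs in exz eyz; apply: clN; rewrite ?inE ?xA ?yA.
    by move: xz yz; rewrite !r'E // => xz yz; apply: (cl _ _ z) => //; exact: inA.
  move=> x y xK; rewrite !inE => /andP [yK yA].
  have xs : x != s by apply: contraNneq sK => <-.
  rewrite (r'E x) //; have [->|ys] := eqVneq y s; first by rewrite r's.
  by rewrite r'E //; apply: rK => //; rewrite !inE yK ys.
(* [s] is simplicial and lies in [K]: put its neighbourhood first in [A :\ s],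
   with [K :\ s] at the front, and [s] itself before everything. *)
have sNB : N \subset A :\ s.
  apply/subsetP=> x; rewrite !inE => /andP [-> xs]; rewrite andbT.
  by apply: contraTneq xs => ->; rewrite eirr.
have KN x : x \in K -> x != s -> x \in N.
  by move=> xK xs; rewrite !inE (subsetP sKA) //=; exact: clK.
have [r [inj cl] rN] := IHn _ _ cardB pB sNB clN.
pose B := (\max_x r x).+1.
have rB x : r x < B by rewrite ltnS leq_bigmax.
(* Offsets by multiples of the strict bound [B] separate [K], the rest of [N] and the other vertices
   into successive bands ordered by [r]; the successor in [c] reserves 0 for [s]. *)
pose off x := if x \in K then 0 else if x \in N then B else B + B.
pose c x := if x == s then 0 else off x + (r x).+1.
have cs : c s = 0 by rewrite /c eqxx.
have cE x : x != s -> c x = off x + (r x).+1 by rewrite /c => /negbTE ->.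
have offO x : x != s -> x \notin N -> off x = B + B.
  move=> xs xN; rewrite /off (negbTE xN) ifF //.
  by apply: contraNF xN => xK; exact: KN.
have offN x : x \in N -> off x <= B by rewrite /off => ->; case: ifP.
have inA x : x \in A -> x != s -> x \in A :\ s by move=> xA xs; rewrite !inE xs.
exists c; first split.
- move=> x y xA yA exy.
  have [xs|xs] := eqVneq x s; have [ys|ys] := eqVneq y s.
  + by move: exy; rewrite xs ys eirr.
  + by rewrite xs cs cE // addnS.
  + by rewrite ys cs cE // addnS.
  have rxy : r x != r y by apply: inj => //; exact: inA.
  rewrite !cE //; move: (rB x) (rB y) rxy; rewrite /off.
  move: (x \in K) (y \in K) (x \in N) (y \in N) (r x) (r y) (B); clear.
  by case=> [] [] [] []; lia.
- move=> x y z xA yA zA exz eyz xz yz xy.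
  have zs : z != s by apply: contraTneq xz => ->; rewrite cs.
  have [zN|zN] := boolP (z \in N).
    have before t : c t < c z -> t = s \/ t \in N.
      move=> tz; have [->|ts] := eqVneq t s; first by left.
      right; apply: contraTT tz => tN; rewrite !cE // offO //.
      by move: (offN z zN) (rB z); move: (off z) (r z) (r t) (B); clear; lia.
    have [xs|xN] := before x xz; have [ys|yN] := before y yz.
    + by move: xy; rewrite xs ys eqxx.
    + by rewrite xs esym; move: yN; rewrite inE => /andP [].
    + by rewrite ys; move: xN; rewrite inE => /andP [].
    exact: clN.
  (* Outside [N], [z] is not a neighbour of [s], and [r] already places all of [N] before [z], so
     its earlier neighbours for [c] are also earlier for [r]. *)
  have before t : t \in A -> e t z -> c t < c z -> t != s /\ r t < r z.
    move=> tA etz tz; have ts : t != s.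
      by apply: contraNneq zN => ts; rewrite inE zA esym -ts.
    split=> //; have [tN|tN] := boolP (t \in N).
      by apply: rN => //; rewrite in_setD zN inA.
    by move: tz; rewrite !cE // !offO // ltn_add2l.
  have [xs rxz] := before x xA exz xz; have [ys ryz] := before y yA eyz yz.
  by apply: (cl _ _ z) => //; exact: inA.
move=> x y xK; rewrite !inE => /andP [yK yA].
have ys : y != s by apply: contraNneq yK => ->.
rewrite (cE y) // /c; case: eqP => _; first by rewrite addnS.
move: (rB x); rewrite /off xK (negbTE yK) add0n => rxB.
apply: leq_ltn_trans rxB _.
by case: ifP => _; rewrite addnS ltnS ?leq_addr // -addnA leq_addr.
Qed.

End ReorderClique.

(** * Adjacency, patterns, acyclicity and single rule steps *)

Section Graphs.
Variable T : finType.
Implicit Types (D G H P : pdgraph T) (x y z w a b c : T).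

Lemma adj_sym G : symmetric (adj G).
Proof. by move=> x y; rewrite /adj und_sym [dir G x y || _]orbC. Qed.

Lemma und_adj G x y : und G x y -> adj G x y.
Proof. by rewrite /adj => ->. Qed.

Lemma dir_adj G x y : dir G x y -> adj G x y.
Proof. by rewrite /adj => ->; rewrite orbT. Qed.

Lemma dir_neq G x y : dir G x y -> x != y.
Proof. by apply: contraTneq => ->; rewrite dir_irrefl. Qed.

Lemma und_neq G x y : und G x y -> x != y.
Proof. by apply: contraTneq => ->; rewrite und_irrefl. Qed.

Lemma dir_und G x y : dir G x y -> und G x y = false.
Proof. by move=> /dir_asym /andP [_ /negbTE]. Qed.

Lemma dir_undC G x y : dir G x y -> und G y x = false.
Proof. by move=> /dir_und; rewrite und_sym. Qed.

Lemma unshielded_arcP G a b c :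
  dir G a b -> dir G c b -> c != a -> ~~ adj G c a -> unshielded_arc G a b.
Proof.
move=> ab cb ca nca; rewrite /unshielded_arc ab.
by apply/existsP; exists c; apply/and3P.
Qed.

Lemma dir_pattern G x y : dir (pattern G) x y = unshielded_arc G x y.
Proof. by rewrite /dir inE. Qed.

Lemma adj_pattern G : adj (pattern G) =2 adj G.
Proof.
move=> x y; rewrite {1}/adj !dir_pattern /und !inE /=.
have [/andP [/dir_adj -> _]|] := boolP (unshielded_arc G x y); first by rewrite orbT.
have [/andP [/dir_adj yx _]|] := boolP (unshielded_arc G y x).
  by rewrite orbT adj_sym yx.
by rewrite !andbT !orbF.
Qed.

Lemma eq_pattern G H :
  adj G =2 adj H -> unshielded_arc G =2 unshielded_arc H -> pattern G = pattern H.
Proof.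
move=> eadj earc; apply: pdgraph_ext => x y; last by rewrite !dir_pattern.
by rewrite /und !inE /= eadj !earc.
Qed.

(** The rank counts ancestors, the vertex included. It grows strictly along [x -> y] because a path
    from [y] back to [x] would close a cycle. *)
Lemma dag_rank D : is_dag D ->
  exists rho : T -> nat, forall x y, dir D x y -> rho x < rho y.
Proof.
case=> _ acyclic; exists (fun x => #|[set y | connect (dir D) y x]|) => x y xy.
apply/proper_card/properP; split.
  by apply/subsetP=> z; rewrite !inE => zx; apply: connect_trans zx (connect1 xy).
exists y; rewrite !inE ?connect0 //; apply/negP=> /connectP [p yp xE].
by have := acyclic (y :: p); rewrite /cycle rcons_path yp -xE xy => /(_ isT).
Qed.

Lemma rank_acyclic D (rho : T -> nat) :
  (forall x y, dir D x y -> rho x < rho y) ->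
  forall s : seq T, cycle (dir D) s -> s = [::].
Proof.
move=> rhoP [//|x p] xp.
have ltx z q : path (dir D) z q -> rho z <= rho (last z q).
  elim: q z => //= y q IHq z /andP [zy yq].
  exact: leq_trans (ltnW (rhoP _ _ zy)) (IHq _ yq).
move: xp; rewrite /cycle rcons_path => /andP [/ltx xl /rhoP lx].
by have := leq_trans lx xl; rewrite ltnn.
Qed.

Lemma dag_total D x y : is_dag D -> adj D x y -> dir D x y \/ dir D y x.
Proof. by case=> /(_ x y) nu _; rewrite /adj (negbTE nu) /= => /orP. Qed.

Lemma rule_applies_und G a b : rule_applies G a b -> und G a b.
Proof. by case=> [[x [_ _ uab _]]|[y [_ _ _ uab]]|[y [z [_ [_ _ uab] _ _]]]]. Qed.

Lemma rule_step_dir G H : rule_step G H -> subrel (dir G) (dir H).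
Proof. by move=> [a [b [_ _ dE]]] x y; rewrite /dir dE inE orbC => ->. Qed.

Lemma rule_step_adj G H : rule_step G H -> adj H =2 adj G.
Proof.
move=> [a [b [/rule_applies_und uab uE dE]]] x y.
rewrite /adj /und /dir uE dE !inE /=.
have [[-> ->]|_] := (x, y) =P (a, b); first by rewrite -/(und G a b) uab.
have [[-> ->]|nba] := (x, y) =P (b, a).
  by rewrite eqxx -/(und G b a) und_sym uab /= !orbT.
by have [[ya xb]|//] := (y, x) =P (a, b); rewrite ya xb in nba.
Qed.

(** * Soundness of the rules *)

(** The invariant of rule application: [G] lies between the pattern of [D] and [D] itself. *)
Definition sound D G :=
  [/\ adj G =2 adj D, subrel (dir G) (dir D) & subrel (unshielded_arc D) (dir G)].

Lemma sound_pattern D : sound D (pattern D).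
Proof.
split=> [|x y|x y]; first exact: adj_pattern.
  by rewrite dir_pattern => /andP [].
by rewrite dir_pattern.
Qed.

Lemma sound_collider D G x y z : sound D G ->
  dir D x z -> dir D y z -> x != y -> ~~ adj G x y -> dir G x z.
Proof.
move=> [eadj _ arcs] xz yz xy nxy; apply: arcs; apply: unshielded_arcP yz _ _ => //.
  by rewrite eq_sym.
by rewrite adj_sym -eadj.
Qed.

(** Suppose [b -> a] in [D]. Under R1 this makes an unshielded collider at [a], whose edges [G]
    would already direct; under R2 it closes a cycle. Under R3 acyclicity forces [y -> a] and
    [z -> a], again an unshielded collider. *)
Lemma rule_sound D G a b : is_dag D -> sound D G -> rule_applies G a b -> dir D a b.
Proof.
move=> dagD sG rab; have uab := rule_applies_und rab.
have [rho rhoP] := dag_rank dagD; have [eadj sub _] := sG.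
have [//|ba] : dir D a b \/ dir D b a.
  by apply: dag_total => //; rewrite -eadj und_adj.
case: rab.
- move=> [x [xb xa _ nxb]].
  have {}xb : x != b by move: xb; rewrite /= !inE negb_or => /andP [/andP []].
  have := sound_collider sG ba (sub _ _ xa); rewrite eq_sym adj_sym => /(_ xb nxb).
  by move=> /dir_undC; rewrite uab.
- move=> [y [_ ay yb _]].
  have := ltn_trans (rhoP _ _ (sub _ _ ay)) (rhoP _ _ (sub _ _ yb)).
  by move=> /ltn_trans /(_ (rhoP _ _ ba)); rewrite ltnn.
move=> [y [z [yz [ay az _] [yb zb] nyz]]].
have {}yz : y != z by move: yz; rewrite /= !inE !negb_or => /and4P [_ /andP []].
have toa t : und G a t -> dir G t b -> dir D t a.
  move=> aT tb; have [at_|//] : dir D a t \/ dir D t a.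
    by apply: dag_total => //; rewrite -eadj und_adj.
  have := ltn_trans (rhoP _ _ at_) (rhoP _ _ (sub _ _ tb)).
  by move=> /ltn_trans /(_ (rhoP _ _ ba)); rewrite ltnn.
have := sound_collider sG (toa y ay yb) (toa z az zb) yz nyz.
by move=> /dir_undC; rewrite ay.
Qed.

Lemma sound_step D G H : is_dag D -> sound D G -> rule_step G H -> sound D H.
Proof.
move=> dagD sG GH; have [eadj sub arcs] := sG; split.
- by move=> x y; rewrite (rule_step_adj GH).
- move=> x y; have [a [b [rab _ dE]]] := GH; rewrite /dir dE !inE.
  by move=> /orP [/eqP [-> ->]|/sub //]; exact: rule_sound rab.
by move=> x y /arcs; exact: rule_step_dir.
Qed.

Notation rule_steps := (clos_refl_trans _ (@rule_step T)).

Lemma rule_steps_dir G H : rule_steps G H -> subrel (dir G) (dir H).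
Proof.
elim=> {G H} [G H /rule_step_dir //|G x y //|G K H _ GK _ KH] x y.
by move=> /GK /KH.
Qed.

Lemma sound_steps D G H : is_dag D -> sound D G -> rule_steps G H -> sound D H.
Proof.
move=> dagD sG GH; elim: GH sG => // [G' H' step sG|G' K' H' _ IH1 _ IH2 /IH1 //].
exact: sound_step sG step.
Qed.

(** * Graphs closed under the rules, and absorption of undirected edges *)

Definition closed_rules H := forall a b, ~ rule_applies H a b.

Lemma closed_R1 H x y z : closed_rules H -> dir H x y -> und H y z -> adj H x z.
Proof.
move=> clH xy yz; apply/negPn/negP=> nxz; apply: (clH y z); constructor 1.
exists x; split=> //=; rewrite !inE negb_or (dir_neq xy) (und_neq yz) !andbT.
by apply: contraTneq xy => ->; apply/negP=> /dir_undC; rewrite yz.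
Qed.

Lemma closed_R2 H x y z : closed_rules H -> dir H x y -> dir H y z -> ~~ und H x z.
Proof.
move=> clH xy yz; apply/negP=> xz; apply: (clH x z); constructor 2.
exists y; split=> //=; rewrite !inE negb_or (dir_neq xy) (dir_neq yz).
by rewrite (und_neq xz).
Qed.

Lemma closed_R3 H x y z w : closed_rules H ->
  und H x y -> und H x z -> und H x w -> dir H y w -> dir H z w -> y != z -> adj H y z.
Proof.
move=> clH xy xz xw yw zw nyz; apply/negPn/negP=> ayz; apply: (clH x w); constructor 3.
exists y, z; split=> //=; rewrite !inE !negb_or nyz (und_neq xy) (und_neq xz).
by rewrite (und_neq xw) (dir_neq yw) (dir_neq zw).
Qed.

(** R1 makes [a] and [c] adjacent, and R2 excludes [c -> a]. *)
Lemma closed_triangle H a b c : closed_rules H ->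
  dir H a b -> und H b c -> dir H a c \/ und H a c.
Proof.
move=> clH ab bc; have /or3P [|->|ca] := closed_R1 clH ab bc; [by right|by left|].
by have := closed_R2 clH ca ab; rewrite und_sym bc.
Qed.

Lemma sound_unshielded_arc D H : sound D H -> unshielded_arc H =2 unshielded_arc D.
Proof.
move=> [eadj sub arcs] x y; apply/idP/idP.
  move=> /andP [xy /existsP [z /and3P [zx nzx zy]]].
  by apply: (unshielded_arcP (sub _ _ xy) (sub _ _ zy)) => //; rewrite -eadj.
move=> /andP [xy /existsP [z /and3P [zx nzx zy]]].
apply: (@unshielded_arcP _ _ _ z) => //; rewrite ?eadj //; apply: arcs.
  exact: unshielded_arcP zy _ _.
by apply: unshielded_arcP xy _ _ => //; rewrite 1?eq_sym 1?adj_sym.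
Qed.

(* For [H] the final graph and [G] an intermediate one, this is what the
   induction along the rule applications carries. *)
Definition absorbs G H := forall a b c, dir G a b -> und H b c -> ~~ und H a c.

(** Let [d -> b] be the other arc of the collider and suppose [a - c]. Then [d -> c] contradicts R1
    at [c - a], and [d - c] contradicts R3 with apex [c]. *)
Lemma pattern_absorbs D H : is_dag D -> closed_rules H -> sound D H ->
  absorbs (pattern D) H.
Proof.
move=> dagD clH sH a b c; rewrite dir_pattern -(sound_unshielded_arc sH).
move=> /andP [ab /existsP [d /and3P [da nda db]]] bc; apply/negP=> ac.
rewrite und_sym in ac; have [dc|dc] := closed_triangle clH db bc.
  by have := closed_R1 clH dc ac; rewrite (negbTE nda).
rewrite und_sym in dc; rewrite und_sym in bc.
by have := closed_R3 clH dc ac bc db ab da; rewrite (negbTE nda).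
Qed.

(** Only the new arc [a' -> b'] matters. If [b' - c] and [a' - c] in [H], the premises of the rule
    that created it are older arcs, so absorption transports them to [c], where they contradict
    closure of [H]. *)
Lemma step_absorbs D G K H : is_dag D -> sound D G -> sound D H -> closed_rules H ->
  subrel (dir K) (dir H) -> rule_step G K -> absorbs G H -> absorbs K H.
Proof.
move=> dagD sG sH clH KH GK absG a b c; have GH : subrel (dir G) (dir H).
  by move=> x y /(rule_step_dir GK) /KH.
have adjGH x y : adj G x y = adj H x y.
  by have [eG _ _] := sG; have [eH _ _] := sH; rewrite eG eH.
have absGH x y z : dir G x y -> und H y z -> dir H x z.
  move=> xy yz; have [//|] := closed_triangle clH (GH _ _ xy) yz.
  by rewrite (negbTE (absG _ _ _ xy yz)).
have [a' [b' [rab _ dE]]] := GK; rewrite /dir dE !inE.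
move=> /orP [/eqP [-> ->]|ab]; last exact: absG.
move=> {a b} bc; apply/negP=> ac.
have ab : dir H a' b' by apply: KH; rewrite /dir dE !inE eqxx.
case: rab.
- move=> [x [_ xa _ nxb]].
  have xc := absGH _ _ _ xa ac.
  move: nxb; rewrite adjGH => /negP; apply; apply: closed_R1 xc _ => //.
  by rewrite und_sym.
- move=> [y [_ ay yb _]]; have yc := absGH _ _ _ yb bc.
  by have := closed_R2 clH (GH _ _ ay) yc; rewrite ac.
move=> [y [z [yz [ay az _] [yb zb]]]]; rewrite adjGH => nyz.
have {}yz : y != z by move: yz; rewrite /= !inE !negb_or => /and4P [_ /andP []].
(* For R3, [y] and [z] both point to [c], so R2 excludes arcs from [a'] to them. Two undirected
   edges contradict R3, a mixed pair contradicts R1, and two arcs into [a'] form an unshielded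
   collider that [G] should already direct. *)
have into t : und G a' t -> dir G t b' -> und H a' t \/ dir H t a'.
  move=> at_ tb; have := und_adj at_; rewrite adjGH => /or3P [|h|]; [by left| |by right].
  by have := closed_R2 clH h (absGH _ _ _ tb bc); rewrite ac.
have [yc zc] := (absGH _ _ _ yb bc, absGH _ _ _ zb bc).
have [uay|ya] := into y ay yb; have [uaz|za] := into z az zb.
- by have := closed_R3 clH uay uaz ac yc zc yz; rewrite (negbTE nyz).
- by have := closed_R1 clH za uay; rewrite adj_sym (negbTE nyz).
- by have := closed_R1 clH ya uaz; rewrite (negbTE nyz).
have [_ sub _] := sH.
have := sound_collider sG (sub _ _ ya) (sub _ _ za) yz; rewrite adjGH => /(_ nyz).
by move=> /dir_undC; rewrite ay.
Qed.

Lemma closure_absorbs D H : is_dag D -> rule_closure (pattern D) H ->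
  forall a b c, dir H a b -> und H b c -> dir H a c.
Proof.
move=> dagD [PH clH] a b c ab bc; have [//|] := closed_triangle clH ab bc.
have sH := sound_steps dagD (sound_pattern D) PH.
(* This form of the closure peels off the last step, so the induction runs forward from the pattern
   while [H] stays fixed. *)
suff abs G : clos_refl_trans_n1 _ (@rule_step T) (pattern D) G ->
    rule_steps G H -> absorbs G H.
  have := abs H (clos_rt_rtn1 _ _ _ _ PH) (rt_refl _ _ _) _ _ _ ab bc.
  by move=> /negbTE ->.
elim=> [_|G1 K GK PG IHG KH]; first exact: pattern_absorbs.
apply: (step_absorbs dagD _ sH clH _ GK).
- exact: sound_steps (sound_pattern D) (clos_rtn1_rt _ _ _ _ PG).
- exact: rule_steps_dir.
by apply: IHG; apply: rt_trans KH; exact: rt_step.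
Qed.

(** * Orienting the undirected part by a rank *)

Section Orientation.
Variables (H : pdgraph T) (r : T -> nat).

(** An undirected edge with tied ranks would disappear; [perfect_rank] rules this out. *)
Definition orient_dset : {set T * T} :=
  dset H :|: [set e in uset H | r e.1 < r e.2].

Lemma orient_subproof : pdgraph_axiom set0 orient_dset.
Proof.
apply/and3P; split.
- by apply/forallP=> x; rewrite !inE /= ltnn andbF orbF -/(dir H x x) dir_irrefl.
- by apply/forallP=> x; apply/forallP=> y; rewrite !inE.
apply/forallP=> x; apply/forallP=> y; apply/implyP; rewrite !inE /= andbT.
rewrite -/(dir H x y) -/(und H x y) -/(dir H y x) -/(und H y x).
move=> /orP [xy|/andP [xy rxy]].
  by have /andP [/negbTE -> _] := dir_asym xy; rewrite (dir_undC xy).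
rewrite negb_or negb_and -leqNgt (ltnW rxy) orbT andbT.
by apply/negP=> /dir_undC; rewrite xy.
Qed.

Definition orient : pdgraph T := PDGraph orient_subproof.

Lemma dir_orient x y : dir orient x y = dir H x y || (und H x y && (r x < r y)).
Proof. by rewrite {1}/dir !inE. Qed.

End Orientation.

Lemma orient_extension D H (r : T -> nat) :
  is_dag D -> rule_closure (pattern D) H -> perfect_rank (und H) setT r ->
  consistent_dag_extension (orient H r) H.
Proof.
move=> dagD hH [inj cl]; have [PH clH] := hH.
have [_ sub _] := sound_steps dagD (sound_pattern D) PH.
have absH := closure_absorbs dagD hH.
have eadj : adj (orient H r) =2 adj H.
  move=> x y; rewrite /adj !dir_orient {1}/und inE /= (und_sym H y x).
  have [xy|_] := boolP (und H x y); last by rewrite !orbF.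
  have := inj x y; rewrite !inE => /(_ isT isT xy).
  by rewrite neq_ltn => /orP [] ->; rewrite !orbT.
have subH : subrel (dir H) (dir (orient H r)) by move=> x y; rewrite dir_orient => ->.
split; first by [].
- split; first by move=> x y; rewrite /und inE.
  have [rho rhoP] := dag_rank dagD.
(* Vertices joined by an undirected edge have the same parents, so [sigma] is
   constant along undirected edges while it increases along directed ones. *)
  pose sigma x := \max_(w | dir H w x) (rho w).+1.
  have sigma_dir x y : dir H x y -> sigma x < sigma y.
    (* Parents of [x] rank below [x] in [D], so [sigma x <= rho x], while [x] as a parent of [y]
       gives [rho x < sigma y]. *)
    move=> xy; apply: (@leq_ltn_trans (rho x)); last exact: leq_bigmax_cond.
    by apply/bigmax_leqP=> w /sub /rhoP.
  have sigma_und x y : und H x y -> sigma x = sigma y.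
    move=> xy; apply: eq_bigl => w; apply/idP/idP => wx; apply: absH wx _ => //.
    by rewrite und_sym.
  pose B := (\max_x r x).+1.
  have rB x : r x < B by rewrite ltnS leq_bigmax.
  (* Since [r] is bounded by [B], this encodes the lexicographic order on [sigma] and [r]. *)
  apply: (@rank_acyclic _ (fun x => sigma x * B + r x)) => x y.
  rewrite dir_orient => /orP [/sigma_dir xy|/andP [/sigma_und -> rxy]].
    apply: (@leq_trans ((sigma x).+1 * B)); first by rewrite mulSn addnC ltn_add2r.
    by rewrite (leq_trans _ (leq_addr _ _)) // leq_mul2r xy orbT.
  by rewrite ltn_add2l.
apply: eq_pattern => // x y; apply/idP/idP; last first.
  move=> /andP [xy /existsP [z /and3P [zx nzx zy]]].
  by apply: (unshielded_arcP (subH _ _ xy) (subH _ _ zy)); rewrite ?eadj.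
move=> /andP [xy /existsP [z /and3P [zx]]]; rewrite eadj => nzx zy.
move: xy zy; rewrite !dir_orient.
(* No new unshielded collider arises: R1 shields one with a single arc from [H], and the clique
   property of [r] shields one with none. *)
move=> /orP [xy|/andP [xy rxy]] /orP [zy|/andP [zy rzy]].
- exact: unshielded_arcP zy _ _.
- by move: nzx; rewrite adj_sym (closed_R1 clH xy) // und_sym.
- by move: nzx; rewrite (closed_R1 clH zy) // und_sym.
by move: nzx; rewrite und_adj // (cl z x y) // inE.
Qed.

(** A topological rank of [D] works. Two earlier neighbours of [z] are its parents in [D], hence
    adjacent, as otherwise [H] would direct the collider; an arc between them in [H] would by
    absorption direct one of their edges to [z]. *)
Lemma closure_perfect_rank D H : is_dag D -> rule_closure (pattern D) H ->
  exists r, perfect_rank (und H) setT r.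
Proof.
move=> dagD hH; have [PH clH] := hH.
have sH := sound_steps dagD (sound_pattern D) PH; have [eadj _ _] := sH.
have [rho rhoP] := dag_rank dagD; exists rho.
have orD x y : und H x y -> dir D x y \/ dir D y x.
  by move=> xy; apply: dag_total => //; rewrite -eadj und_adj.
split=> [x y _ _ /orD [] /rhoP|x y z _ _ _ xz yz rxz ryz xy].
- by rewrite neq_ltn => ->.
- by rewrite neq_ltn orbC => ->.
have toz t : und H t z -> rho t < rho z -> dir D t z.
  by move=> /orD [//|/rhoP zt /(ltn_trans zt)]; rewrite ltnn.
have absH := closure_absorbs dagD hH.
have /or3P [//|a|a] : adj H x y.
- apply/negPn/negP=> nxy.
  have := sound_collider sH (toz x xz rxz) (toz y yz ryz) xy nxy.
  by move=> /dir_und; rewrite xz.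
- by have := absH _ _ _ a yz => /dir_und; rewrite xz.
by have := absH _ _ _ a xz => /dir_und; rewrite yz.
Qed.

(** Moving the singleton clique [[set a]] to the front makes every undirected edge at [a] point away
    from it. *)
Lemma closure_extension D H a b : is_dag D -> rule_closure (pattern D) H ->
  und H a b -> exists2 G, consistent_dag_extension G H & dir G a b.
Proof.
move=> dagD hH ab; have [r0 pr0] := closure_perfect_rank dagD hH.
have usym : symmetric (und H) by move=> x y; rewrite und_sym.
have uirr : irreflexive (und H) by move=> x; rewrite und_irrefl.
have [|r pr ra] := perfect_rank_prefix usym uirr pr0 (subsetT [set a]).
  by move=> x y /set1P -> /set1P ->; rewrite eqxx.
exists (orient H r); first exact: orient_extension dagD hH pr.
by rewrite dir_orient ab ra ?orbT // !inE ?eqxx // andbT eq_sym (und_neq ab).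
Qed.

End Graphs.

Theorem theorem3 (T : finType) (D P P0 : pdgraph T)
  (hD : is_dag D) (hP : P = pattern D) (hP0 : rule_closure P P0) :
  maximally_oriented P0.
Proof.
move=> a b ab; rewrite hP in hP0.
have [G1 G1P G1ab] := closure_extension hD hP0 ab.
rewrite und_sym in ab; have [G2 G2P G2ba] := closure_extension hD hP0 ab.
by exists G1, G2.
Qed.
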